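(* Let $t \ge 3$ be an integer. For every $N \in \mathbb{N}$ there exists a $t$-chordal digraph $D$ with $\omega(D) \le 3$ and $\vec{\chi}(D) \ge N$; moreover, if $t > 3$, then such a $D$ exists with $\omega(D) \le 2$.
   Context: All digraphs are finite and simple: no loops, no parallel edges, and for two vertices $u,v$ not both of the edges $uv$ and $vu$ are present. A digraph is acyclic if it has no directed cycle. A $k$-dicoloring of a digraph $D$ is a function $f: V(D) \to \{1,\dots,k\}$ such that for each $i$, $f^{-1}(i)$ induces an acyclic subdigraph of $D$. The dichromatic number $\vec{\chi}(D)$ is the minimum $k$ such that $D$ has a $k$-dicoloring. $\omega(D)$ denotes the clique number of the underlying undirected graph of $D$ (two vertices adjacent iff $uv$ or $vu$ is an edge of $D$). For an integer $t \ge 2$, a digraph is $t$-chordal if every induced directed cycle in it has length exactly $t$. *)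

(* Defs.v *)
From mathcomp Require Import all_boot.
From mathcomp Require Import boolp.

Set Implicit Arguments.
Unset Strict Implicit.
Unset Printing Implicit Defensive.

Record digraph := Digraph {
  vertex :> finType;
  arc : rel vertex;
  arc_irr : irreflexive arc;
  arc_asym : forall u v, arc u v -> ~~ arc v u }.

Definition adjacent (D : digraph) (u v : D) : bool := arc u v || arc v u.

Definition is_clique (D : digraph) (K : {set D}) : bool :=
  [forall u in K, forall v in K, (u != v) ==> adjacent u v].

Definition omega (D : digraph) : nat :=
  \max_(K : {set D} | is_clique K) #|K|.

Section Induced.
Variables (D : digraph) (A : {set D}).

Definition induced_vertex : finType := {v : D | v \in A}.

Definition induced_arc : rel induced_vertex :=
  [rel u v | arc (val u) (val v)].

Lemma induced_arc_irr : irreflexive induced_arc.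
Proof. by move=> u; exact: arc_irr. Qed.

Lemma induced_arc_asym u v : induced_arc u v -> ~~ induced_arc v u.
Proof. exact: arc_asym. Qed.

Definition induced : digraph := Digraph induced_arc_irr induced_arc_asym.

End Induced.

(* A directed cycle is the list of its distinct vertices in cyclic order; its
   length is the size of the list. MathComp's [ucycle] also accepts the empty
   list, which is excluded here; sizes 1 and 2 cannot occur, as there are no
   loops and no pairs of opposite arcs. *)
Definition dicycle (D : digraph) (c : seq D) : Prop :=
  c != [::] /\ ucycle (@arc D) c.

(* The only arcs of [D] between vertices of [c] are those of the cycle. *)
Definition induced_dicycle (D : digraph) (c : seq D) : Prop :=
  dicycle c /\ {in c &, forall u v, arc u v -> v = next c u}.

Definition acyclic (D : digraph) : Prop := forall c : seq D, ~ dicycle c.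

Definition chordal (t : nat) (D : digraph) : Prop :=
  forall c : seq D, induced_dicycle c -> size c = t.

Definition dicoloring (D : digraph) (k : nat) (f : D -> 'I_k) : Prop :=
  forall i : 'I_k, acyclic (induced [set v | f v == i]).

Definition dicolorable (D : digraph) (k : nat) : Prop :=
  exists f : D -> 'I_k, dicoloring f.

Lemma dicolorable_card (D : digraph) : dicolorable D #|D|.
Proof.
exists (@enum_rank D) => i [|x c] [nz /andP[xc _]]; first by [].
have same (u v : induced [set v | enum_rank v == i]) : u = v.
  apply: val_inj; apply: enum_rank_inj.
  have := valP u; have := valP v.
  by rewrite !inE => /eqP -> /eqP ->.
have loop (u v : induced [set v | enum_rank v == i]) : ~ arc u v.
  by rewrite (same v u) => /idP; rewrite arc_irr.
by case: c xc {nz} => [|y c] /= /andP[xy _]; exact: loop xy.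
Qed.

Lemma dicolorable_ex (D : digraph) : exists k, `[< dicolorable D k >].
Proof. by exists #|D|; apply/asboolP; exact: dicolorable_card. Qed.

Definition dichromatic (D : digraph) : nat := ex_minn (dicolorable_ex D).

(* Main.v *)
Require Import Defs.
From mathcomp Require Import all_boot.
From mathcomp Require Import boolp zify.

(** Let [e] be an acyclic digraph in which any two walks with the same ends have
    the same length.  Adding an arc [w -> x] for every walk of length [t - 1]
    from [x] to [w] gives a digraph D in which a clique is a chain of [e] whose
    distances all lie in [{1, t - 1}], so that omega D <= 3, and omega D <= 2
    if t > 3.  A color class of a dicoloring of D contains no walk of [e] with
    [t] vertices, so k dicolors give a proper k (t - 1)-coloring of [e] (Gallai
    and Roy), and it suffices that [e] has large chromatic number.

    As [e], take a nested form of Zykov's graphs: where Zykov attaches one new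
    vertex to each transversal of disjoint graphs D_1, ..., D_m, each vertex of
    D_1 gets its own copy of D_2, each vertex of that copy its own copy of D_3,
    and so on.  This tree structure yields that every directed cycle of D
    contains, among its vertices, a walk of [e] with [t] vertices ending in a
    back arc; an induced cycle is then this walk with its back arc. *)

Set Implicit Arguments.
Unset Strict Implicit.
Unset Printing Implicit Defensive.

(** * Walks and distances in a graded digraph *)

Section Walks.
Variables (V : finType) (e : rel V).

Definition walk (n : nat) (u v : V) : bool :=
  [exists p : n.-tuple V, path e u p && (last u p == v)].

(** [d u v] is the common length of all walks from [u] to [v]; [d u u = 0] then rules out nonempty
    closed walks. *)
Definition graded : Prop := exists2 d : V -> V -> nat,
  forall u, d u u = 0 &
  forall u v w, connect e u v -> e v w -> d u w = (d u v).+1.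

Definition inside (S : pred V) : rel V := [rel u v | [&& S u, S v & e u v]].

(* Only arcs inside S and "jumps" from [a] back to some [b] that reaches [a] but
   not within S are allowed; they form no cycle, as witnessed by [r].  This does
   not mention [t], which makes it stable under the nested construction. *)
Definition rankable : Prop := forall S : pred V, exists r : V -> nat,
  forall a b, S a -> S b ->
    e a b \/ connect e b a /\ ~~ connect (inside S) b a -> r a < r b.

Lemma walkP n u v :
  reflect (exists p, [/\ size p = n, path e u p & last u p = v]) (walk n u v).
Proof.
apply: (iffP existsP) => [[p /andP[up /eqP pv]]|[p [pn up pv]]].
  by exists p; rewrite size_tuple.
by exists (Tuple (introT eqP pn)); rewrite /= up pv eqxx.
Qed.

Lemma walk0 u : walk 0 u u.
Proof. by apply/walkP; exists [::]. Qed.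

Lemma walk_rcons n u v w : walk n u v -> e v w -> walk n.+1 u w.
Proof.
move=> /walkP[p [<- up pv]] vw; apply/walkP; exists (rcons p w).
by rewrite size_rcons last_rcons rcons_path up pv.
Qed.

Lemma walk_connect n u v : walk n u v -> connect e u v.
Proof. by move=> /walkP[p [_ up <-]]; apply/connectP; exists p. Qed.

Lemma sub_inside S : subrel (inside S) e.
Proof. by move=> u v /and3P[]. Qed.

Section Distance.
Variable d : V -> V -> nat.
Hypothesis d0 : forall u, d u u = 0.
Hypothesis dS : forall u v w, connect e u v -> e v w -> d u w = (d u v).+1.

Lemma dist_path u p : path e u p -> size p = d u (last u p).
Proof.
elim/last_ind: p => [|p w IHp]; first by rewrite d0.
rewrite rcons_path last_rcons size_rcons => /andP[up pw].
by rewrite (dS _ pw) ?IHp //; apply/connectP; exists p.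
Qed.

Lemma dist_walk n u v : walk n u v -> d u v = n.
Proof. by move=> /walkP[p [<- up <-]]; rewrite (dist_path up). Qed.

Lemma dist_add u v w :
  connect e u v -> connect e v w -> d u w = d u v + d v w.
Proof.
move=> /connectP[p up ->] /connectP[q pq ->].
have upq : path e u (p ++ q) by rewrite cat_path up.
rewrite -(dist_path up) -(dist_path pq) -size_cat -last_cat.
by rewrite (dist_path upq).
Qed.

Lemma dist_eq0 u v : connect e u v -> d u v = 0 -> u = v.
Proof. by move=> /connectP[[|x p] up ->] //; rewrite -(dist_path up). Qed.

Lemma connect_anti u v : connect e u v -> connect e v u -> u = v.
Proof.
by move=> uv vu; apply: dist_eq0 => //; have := dist_add uv vu; rewrite d0; lia.
Qed.

Lemma uniq_walk u p : path e u p -> uniq (u :: p).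
Proof.
move=> up; pose lt := [rel x y | connect e x y && (x != y)].
have lt_irr : irreflexive lt by move=> x /=; rewrite eqxx andbF.
have lt_tr : transitive lt.
  move=> y x z /= /andP[xy nxy] /andP[yz _].
  rewrite (connect_trans xy yz) /=; apply: contraNneq nxy => xz.
  by rewrite (connect_anti xy) // xz.
apply: (sorted_uniq lt_tr lt_irr); apply: sub_path up => x y xy /=.
rewrite connect1 //; apply: contraTneq xy => <-; apply/negP => xx.
by have := dS (connect0 e x) xx; rewrite d0.
Qed.

End Distance.
End Walks.

Lemma connect_homo (V W : finType) (r : rel V) (r' : rel W) (h : V -> W) :
  {homo h : x y / r x y >-> r' x y} ->
  {homo h : x y / connect r x y >-> connect r' x y}.
Proof.
move=> hr x y /connectP[p xp ->]; apply/connectP.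
by exists (map h p); rewrite ?last_map //; exact: homo_path hr xp.
Qed.

Lemma connect_ind (V : finType) (r : rel V) (P : V -> Prop) x y :
  (forall u v, r u v -> P u -> P v) -> connect r x y -> P x -> P y.
Proof.
move=> rP /connectP[p]; elim: p x => [|z p IHp] x /=; first by move=> _ ->.
by move=> /andP[xz zp] py /(rP _ _ xz); exact: IHp.
Qed.

(** * Nesting: a copy of one digraph attached at each vertex of another *)

Section Attach.
Variables (V W : finType) (e : rel V) (f : rel W) (A : pred W).
Hypothesis A_source : forall u v, A v -> ~~ f u v.

Definition attach : rel (V + V * W) := fun u v =>
  match u, v with
  | inl a, inl b => e a b
  | inl _, inr _ => false
  | inr (x, b), inl a => (x == a) && A b
  | inr (x, b), inr (y, c) => (x == y) && f b c
  end.

Lemma connect_source u v : A v -> connect f u v -> u = v.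
Proof.
move=> Av /connectP[p]; case/lastP: p => [//|p w].
rewrite rcons_path last_rcons => /andP[_ pw] vw.
by have := A_source (last u p) Av; rewrite vw pw.
Qed.

Lemma attach_connectl a z :
  connect attach (inl a) z -> if z is inl b then connect e a b else false.
Proof.
move=> az; pattern z; apply: connect_ind az (connect0 _ _).
move=> [b|[x b]] [c|[y c]] //= bc ab.
exact: connect_trans ab (connect1 bc).
Qed.

Lemma attach_connectr x b z : connect attach (inr (x, b)) z ->
  match z with
  | inl a => A b /\ connect e x a
  | inr (y, c) => x = y /\ connect f b c
  end.
Proof.
move=> bz; pattern z; apply: connect_ind bz _; last by split.
move=> [a|[y c]] [a'|[y' c']] //=.
- by move=> aa' [Ab xa]; split=> //; exact: connect_trans xa (connect1 aa').
- move=> /andP[/eqP <- Ac] [<- bc]; split; last exact: connect0.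
  by rewrite (connect_source Ac bc).
- move=> /andP[/eqP <- cc'] [<- bc]; split=> //.
  exact: connect_trans bc (connect1 cc').
Qed.

Lemma graded_attach : graded e -> graded f -> graded attach.
Proof.
move=> [d d0 dS] [g g0 gS].
pose h (u v : V + V * W) := match u, v with
  | inl a, inl b => d a b
  | inl _, inr _ => 0
  | inr (x, _), inl a => (d x a).+1
  | inr (_, b), inr (_, c) => g b c
  end.
exists h => [[a|[x b]] //=|[a|[x b]] v w].
  move=> /attach_connectl; case: v w => [b|[y b]] [c|[z c]] //=.
  exact: dS.
move=> /attach_connectr; case: v w => [a|[y c]] [a'|[y' c']] //=.
- by move=> [_ xa] aa'; rewrite (dS _ _ _ xa).
- move=> [<- bc] /andP[/eqP <- Ac]; rewrite (connect_source Ac bc).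
  by rewrite d0 g0.
- by move=> [_ bc] /andP[_ cc']; exact: gS.
Qed.

(** Inside [e] and inside each copy the given ranks apply. Otherwise, arcs go only from a copy to
    its own vertex, and jumps only from some [a] in [e] to a copy, at [y] say. If [y] is in [S],
    then [a] also jumps to [y]. *)
Lemma rankable_attach : rankable e -> rankable f -> rankable attach.
Proof.
move=> er fr S.
have [r rP] := er (fun a => S (inl a)).
have /choice[s sP] := fun x => fr (fun b => S (inr (x, b))).
pose M := \max_x \max_b s x b.
pose N := \max_x r x.
have sM x b : s x b <= M.
  exact: leq_trans (leq_bigmax b) (leq_bigmax (F := fun x => \max_b s x b) x).
have rN x : r x <= N by exact: leq_bigmax.
(* The copy at [x] goes just before [x], or last of all when [x] is not in S. *)
pose q x := if S (inl x) then r x else N.+1.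
(* Blocks of length [M.+2]: the copy at [x] uses offsets up to [M], and [x] itself has offset
   [M.+1]. *)
exists (fun u => match u with
  | inl a => r a * M.+2 + M.+1
  | inr (x, b) => q x * M.+2 + s x b
  end).
have rlt a b i j : a < b -> i < M.+2 -> a * M.+2 + i < b * M.+2 + j.
  by move=> ab iM; have := leq_mul ab (leqnn M.+2); lia.
move=> [a|[x b]] [a'|[y c]] Su Sv /=.
- move=> H; apply: rlt => //; apply: rP => //.
  case: H => [|[/attach_connectl ba /negP nba]]; first by left.
  right; split=> //; apply/negP => ba'; apply: nba.
  apply: connect_homo ba' => z z' /and3P[Sz Sz' zz'].
  exact/and3P.
- case=> [//|[/attach_connectr [Ac ya] /negP nya]].
  apply: rlt => //; rewrite /q; case: ifP => [Sy|_]; last by rewrite ltnS.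
  apply: rP => //; right; split=> //; apply/negP => ya'; apply: nya.
  have yy : inside attach S (inr (y, c)) (inl y).
    by apply/and3P; split=> //=; rewrite eqxx.
  apply: connect_trans (connect1 yy) _.
  apply: connect_homo ya' => z z' /and3P[Sz Sz' zz'].
  exact/and3P.
- case=> [/andP[/eqP xa _]|[/attach_connectl //]]; subst a'.
  by rewrite /q Sv; have := sM x b; lia.
- case=> [/andP[/eqP xy bc]|[/attach_connectr [xy cb] /negP ncb]].
    by subst y; rewrite ltn_add2l; apply: sP => //; left.
  subst y; rewrite ltn_add2l; apply: sP => //; right; split=> //.
  apply/negP => cb'; apply: ncb.
  apply: (connect_homo (h := fun b => inr (x, b))) cb'.
  move=> z z' /and3P[Sz Sz' zz'].
  by apply/and3P; split=> //=; rewrite eqxx.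
Qed.

End Attach.

(** * Colors seen by a source *)

Definition proper (V : finType) (e : rel V) (col : V -> nat) : Prop :=
  forall u v, e u v -> col u <> col v.

(* Every proper coloring has a vertex of A seeing [n] colors outside any given
   set C of at most [i] colors; C holds the colors picked at outer levels. *)
Definition sees (V : finType) (e : rel V) (A : pred V) (i n : nat) : Prop :=
  forall col, proper e col -> forall C : seq nat, size C <= i ->
  exists v s, [/\ A v, uniq s, size s = n &
    forall c, c \in s -> c \notin C /\ exists2 w, e v w & col w = c].

Definition source_sees (i n : nat) : Prop :=
  exists (V : finType) (e : rel V) (A : pred V), [/\ graded e, rankable e,
    forall u v, A v -> ~~ e u v & sees e A i n].

(** A vertex that sees [i] colors has yet another color itself, and [C] cannot contain all [i.+1] of
    them. *)
Lemma sees_avoid (V : finType) (e : rel V) (A : pred V) i :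
  sees e A 0 i -> forall col, proper e col ->
  forall C : seq nat, size C <= i -> exists x, col x \notin C.
Proof.
move=> eA col pcol C sC.
have [v [s [_ us ss sP]]] := eA col pcol [::] isT.
have vs : col v \notin s.
  by apply/negP => /sP[_ [w vw /esym]]; exact: pcol.
have /allPn[c cs cC] : ~~ all [in C] (col v :: s).
  apply/negP => /allP sub; have := uniq_leq_size _ sub.
  by rewrite /= vs us ss => /(_ isT); lia.
move: cs; rewrite inE => /orP[/eqP cv|/sP[_ [w _ wc]]].
  by exists v; rewrite -cv.
by exists w; rewrite wc.
Qed.

Lemma source_sees0 i : source_sees i 0.
Proof.
exists unit, (fun _ _ => false), predT; split=> //.
- by exists (fun _ _ => 0).
- by move=> S; exists (fun=> 0) => [[] []] _ _ [//|[_]]; rewrite connect0.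
- by move=> col _ C _; exists tt, [::]; split.
Qed.

(** Some [x] of the first digraph has a color outside [C]. Forbidding this color too in the copy at
    [x] gives a source that sees [n] other colors there, and the color of [x] through its arc to
    [x]. *)
Lemma source_seesS i n :
  source_sees 0 i -> source_sees i.+1 n -> source_sees i n.+1.
Proof.
move=> [V [e [A0 [ge re _ eA]]]] [W [f [A [gf rf Af fA]]]].
exists (V + V * W)%type, (attach e f A),
  (fun u => if u is inr (_, b) then A b else false); split.
- exact: graded_attach.
- exact: rankable_attach.
- by move=> [a|[x b]] [a'|[y c]] //= /Af fc; rewrite negb_and fc orbT.
move=> col pcol C sC.
have [x xC] : exists x, col (inl x) \notin C.
  by apply: (sees_avoid eA) (sC) => u v uv; exact: pcol.
have [||v [s [Av us ss sP]]] :=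
  fA (fun b => col (inr (x, b))) _ (col (inl x) :: C).
- by move=> u v uv; apply: pcol; rewrite /= eqxx.
- exact: sC.
exists (inr (x, v)), (col (inl x) :: s); split=> //=.
- rewrite us andbT; apply/negP => /sP[].
  by rewrite inE eqxx.
- by rewrite ss.
move=> c; rewrite inE => /orP[/eqP ->|/sP[cC [w vw wc]]].
  by split=> //; exists (inl x) => //=; rewrite eqxx.
split; first by apply: contra cC; rewrite inE orbC => ->.
by exists (inr (x, w)) => //=; rewrite eqxx.
Qed.

(** Lexicographic induction on [(i + n, n)]: of the two premises of [source_seesS], one has a
    smaller sum, the other the same sum and a smaller [n]. *)
Lemma source_sees_all i n : source_sees i n.
Proof.
have [k] := ubnP (i + n); elim: k i n => // k IHk i n.
elim: n i => [|n IHn] i ink; first exact: source_sees0.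
by apply: source_seesS; [apply: IHk | apply: IHn]; lia.
Qed.

(** * Adding the back arcs *)

Section BackArcs.
Variables (V : finType) (e : rel V) (d : V -> V -> nat).
Hypothesis d0 : forall u, d u u = 0.
Hypothesis dS : forall u v w, connect e u v -> e v w -> d u w = (d u v).+1.
Variables (t : nat) (t_ge3 : 3 <= t).

Definition back_arc : rel V := [rel u v | e u v || walk e t.-1 v u].

Lemma dist_arc u v : e u v -> d u v = 1.
Proof. by move=> uv; rewrite (dS (connect0 e u) uv) d0. Qed.

Lemma back_irr : irreflexive back_arc.
Proof.
move=> u; apply/negP => /orP[/dist_arc|/(dist_walk d0 dS)]; rewrite d0; lia.
Qed.

Lemma back_asym u v : back_arc u v -> ~~ back_arc v u.
Proof.
have loop x y : connect e x y -> connect e y x -> 0 < d x y -> False.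
  by move=> xy yx; rewrite (connect_anti d0 dS xy yx) d0.
move=> /orP[uv|vu]; apply/negP => /orP[vu'|uv'].
- by apply: (@loop u v); rewrite ?connect1 // dist_arc.
- by have := dist_walk d0 dS uv'; rewrite dist_arc //; lia.
- by have := dist_walk d0 dS vu; rewrite dist_arc //; lia.
- apply: (loop u v (walk_connect uv') (walk_connect vu)).
  by rewrite (dist_walk d0 dS uv'); lia.
Qed.

Definition back_digraph : digraph := Digraph back_irr back_asym.

(** The rank for the vertex set of [c] cannot increase along every arc of [c]. Where it does not,
    the arc is a back arc whose ends are joined by a walk of [e] inside [c]. *)
Lemma back_chordal : rankable e -> chordal t back_digraph.
Proof.
move=> re c [[cn0 /andP[cc uc]] indc].
have [r rP] := re [in c].
have [a ac nr] : exists2 a, a \in c & r (next c a) <= r a.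
  case: c cn0 {cc uc indc rP} => // x c _.
  case: (@arg_maxnP _ x [in x :: c] r (mem_head x c)) => a ain amax.
  by exists a => //; apply: amax; rewrite mem_next.
have bc : next c a \in c by rewrite mem_next.
set b := next c a in nr bc.
have ab : back_arc a b := next_cycle cc ac.
have ba : walk e t.-1 b a.
  case/orP: ab => // ab.
  by have := rP a b ac bc (or_introl ab); lia.
have /connectP[p bp pa] : connect (inside e [in c]) b a.
  apply: contraT => nab.
  by have := rP a b ac bc (or_intror (conj (walk_connect ba) nab)); lia.
have bpe : path e b p := sub_path (@sub_inside _ _ _) bp.
have sp : size (b :: p) = t.
  by rewrite /= (dist_path d0 dS bpe) -pa (dist_walk d0 dS ba); lia.
(* As [c] is induced, the walk follows [next c], so it runs through the whole orbit of [b], which is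
   [c]. *)
have fbp : fcycle (next c) (b :: p).
  rewrite /= rcons_path -pa /= eqxx andbT.
  apply: sub_path bp => u v /and3P[uc' vc uv] /=.
  by apply/eqP/esym; apply: indc => //; rewrite /= /back_arc /= uv.
rewrite -sp -(order_cycle fbp (uniq_walk d0 dS bpe) (mem_head b p)).
by rewrite (order_cycle (cycle_next uc) uc bc).
Qed.

Lemma adjacent_dist (u v : back_digraph) : u != v -> connect e u v ->
  adjacent u v -> d u v = 1 \/ d u v = t.-1.
Proof.
move=> uv cuv; have nvu : ~ connect e v u.
  by move=> vu; case/eqP: uv; exact: (connect_anti d0 dS).
case/orP => /orP[|w].
- by left; exact: dist_arc.
- by case: nvu; exact: walk_connect w.
- by move=> vu; case: nvu; exact: connect1.
- by right; exact: (dist_walk d0 dS).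
Qed.

Lemma clique_chain (K : {set back_digraph}) : is_clique K ->
  exists s : seq V, [/\ size s = #|K|, pairwise (connect e) s &
    pairwise (fun u v => (d u v == 1) || (d u v == t.-1)) s].
Proof.
move=> /forall_inP Kc.
have adj u v : u \in K -> v \in K -> u != v -> adjacent u v.
  by move=> uK vK; have /forall_inP/(_ v vK)/implyP := Kc u uK.
have tot : {in K &, total (connect e)}.
  move=> u v uK vK; case: (eqVneq u v) => [->|uv]; first by rewrite connect0.
  case/orP: (adj u v uK vK uv) => /orP[?|w]; apply/orP.
  - by left; exact: connect1.
  - by right; exact: walk_connect w.
  - by right; exact: connect1.
  - by left; exact: walk_connect w.
pose s := sort (connect e) (enum K).
have sK u : u \in s -> u \in K by rewrite mem_sort mem_enum.
have ps : pairwise (connect e) s.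
  rewrite -sorted_pairwise; last exact: connect_trans.
  by apply: (sort_sorted_in tot); apply/allP => u; rewrite mem_enum.
have us : pairwise (fun u v => u != v) s.
  by rewrite -uniq_pairwise sort_uniq enum_uniq.
exists s; split=> //; first by rewrite size_sort cardE.
have : pairwise [rel u v | connect e u v && (u != v)] s.
  by rewrite pairwise_relI ps us.
apply: (@sub_in_pairwise _ [in K]); last by apply/allP => u /sK.
move=> u v uK vK /= /andP[uv nuv].
by case: (adjacent_dist nuv uv (adj u v uK vK nuv)) => ->; rewrite eqxx ?orbT.
Qed.

(** In a chain of four, [d x z] is a sum of two positive distances, hence [t.-1]; then [d x w] is
    too large. *)
Lemma back_omega3 : omega back_digraph <= 3.
Proof.
apply/bigmax_leqP => K /clique_chain[s [<- cs ds]].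
case: s cs ds => [|x [|y [|z [|w s]]]] //=.
move=> /andP[/and4P[xy xz _ _] /andP[/and3P[yz _ _] /andP[/andP[zw _] _]]].
move=> /andP[/and4P[dxy dxz dxw _]].
move=> /andP[/and3P[dyz _ _] /andP[/andP[dzw _] _]].
have := dist_add d0 dS xy yz; have := dist_add d0 dS xz zw.
move: dxy dxz dxw dyz dzw; lia.
Qed.

(** A sum of two distances from {1, t - 1} is 2, t or 2t - 2, which is again in this set only for t
    = 3. *)
Lemma back_omega2 : 3 < t -> omega back_digraph <= 2.
Proof.
move=> t3; apply/bigmax_leqP => K /clique_chain[s [<- cs ds]].
case: s cs ds => [|x [|y [|z s]]] //=.
move=> /andP[/and3P[xy xz _] /andP[/andP[yz _] _]].
move=> /andP[/and3P[dxy dxz _] /andP[/andP[dyz _] _]].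
have := dist_add d0 dS xy yz; move: dxy dxz dyz; lia.
Qed.

Lemma path_acyclic_size (A : {set back_digraph}) (u : V) (p : seq V) :
  acyclic (induced A) -> {subset u :: p <= A} -> path e u p -> size p <> t.-1.
Proof.
move=> acA sA up sp.
have [c cE] : exists c : seq (induced A), map val c = u :: p.
  elim: (u :: p) sA => [|x q IHq] sA; first by exists [::].
  have [|c <-] := IHq; first by move=> y yq; apply: sA; rewrite inE yq orbT.
  by exists (exist _ x (sA x (mem_head x q)) :: c).
apply: (acA c); split; first by case: c cE.
apply/andP; split; last first.
  by rewrite -(map_inj_uniq val_inj) cE (uniq_walk d0 dS up).
have : cycle back_arc (map val c).
  rewrite cE /= rcons_path; apply/andP; split.
    by apply: sub_path up => x y xy; apply/orP; left.
  by apply/orP; right; apply/walkP; exists p.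
by rewrite cycle_map.
Qed.

Lemma dicolorable_proper (k : nat) : dicolorable back_digraph k ->
  exists2 col, proper e col & forall v, col v < k * t.-1.
Proof.
case=> f fP; pose m := [rel u v | e u v && (f u == f v)].
pose P v := [pred n : 'I_t | [exists u, walk m n u v]].
(* The longest monochromatic walk ending at [v], among lengths below [t]. By [short] the length
   [t.-1] does not occur, so one more arc stays in range. *)
pose l v := \max_(n in P v) n.
have short n u v : walk m n u v -> n <> t.-1.
  move=> /walkP[p [<- up _]].
  have upe : path e u p by apply: sub_path up => x y /andP[].
  apply: path_acyclic_size (fP (f u)) _ upe => x.
  rewrite 2!inE => /predU1P[-> //|xp].
  have tr : transitive (fun x y => f x == f y).
    by move=> y z w /eqP -> /eqP ->.
  have /(order_path_min tr)/allP/(_ x xp) : path (fun x y => f x == f y) u p.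
    by apply: sub_path up => y z /andP[].
  by rewrite eq_sym.
have lt_t v : l v < t.-1.
  rewrite -[t.-1]prednK; last lia.
  rewrite ltnS; apply/bigmax_leqP => n /existsP[u /short].
  by have := ltn_ord n; lia.
have l_arc u v : m u v -> l u < l v.
  move=> uv; have t_gt0 : 0 < t by lia.
  have P0 : 0 < #|P u|.
    apply/card_gt0P; exists (Ordinal t_gt0); rewrite inE.
    by apply/existsP; exists u; exact: walk0.
  have [n /existsP[w wu] lun] := eq_bigmax_cond (fun n : 'I_t => n : nat) P0.
  have wv := walk_rcons wu uv; have nt : n.+1 < t.
    by have := short _ _ _ wu; have := ltn_ord n; lia.
  rewrite /l lun; apply: (leq_bigmax_cond (Ordinal nt)).
  by apply/existsP; exists w.
exists (fun v => f v * t.-1 + l v) => [u v uv fuv|v]; last first.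
  by have := leq_mul (ltn_ord (f v)) (leqnn t.-1); have := lt_t v; lia.
(* The new color is the pair of [f v] and [l v], written in base [t.-1]. *)
have fE : f u = f v :> nat.
  have := congr1 (divn^~ t.-1) fuv.
  by rewrite !divnMDl ?divn_small ?addn0 //; lia.
have : l u < l v by apply: l_arc; rewrite /= uv; apply/eqP/val_inj.
by move: fuv; rewrite fE; lia.
Qed.

End BackArcs.

Theorem theorem1p1 (t : nat) (ht : 3 <= t) (N : nat) :
  (exists D : digraph, [/\ chordal t D, omega D <= 3 & N <= dichromatic D]) /\
  (3 < t ->
   exists D : digraph, [/\ chordal t D, omega D <= 2 & N <= dichromatic D]).
Proof.
(* With [k] dicolors only [k * t.-1] proper colors are available, so seeing [N * t.-1] of them
   forces [N <= k]. *)
have [V [e [A [[d d0 dS] re _ eA]]]] := source_sees_all 0 (N * t.-1).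
have chi : N <= dichromatic (back_digraph d0 dS ht).
  rewrite /dichromatic; case: ex_minnP => k /asboolP /dicolorable_proper.
  move=> [col pcol colk] _.
  have [v [s [_ us ss sP]]] := eA col pcol [::] isT.
  have : size s <= size (iota 0 (k * t.-1)).
    apply: uniq_leq_size us _ => c /sP[_ [w _ <-]].
    by rewrite mem_iota /=; exact: colk.
  by rewrite ss size_iota leq_pmul2r //; lia.
have ch : chordal t (back_digraph d0 dS ht) by exact: back_chordal.
split=> [|t3]; exists (back_digraph d0 dS ht); split=> //.
- exact: back_omega3.
- exact: back_omega2.
Qed.
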